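(* Let $r\ge1$ and let $P_r^A=\Phi^+(A_r)$ be the standard positive-root poset of type $A_r$, graded by $\rho=$ root height minus one. Then $$\mathbb{H}_{P_r^A,\rho}(q,t)=\sum_{w\in\{L,R\}^{r-1}}q^{\sum_{j\in D(w)}(j-1)}\,t^{|D(w)|}.$$ In particular, this $q$-Zeta numerator is coefficientwise nonnegative for every $r\ge1$, and for $1\le k\le\lfloor r/2\rfloor$, $$[t^k]\,\mathbb{H}_{P_r^A,\rho}(q,t)=q^{k(k-1)}\sum_{h=k}^{r-k}\genfrac{[}{]}{0pt}{}{h-1}{k-1}_q\genfrac{[}{]}{0pt}{}{r-h}{k}_q.$$ The coefficients of $t^k$ vanish for $k>\lfloor r/2\rfloor$, while the constant coefficient is $1$. At $q=1$, $$\mathbb{H}_{P_r^A,\rho}(1,t)=\sum_{k=0}^{\lfloor r/2\rfloor}\binom{r}{2k}t^k=\frac{(1+\sqrt t)^r+(1-\sqrt t)^r}{2}.$$ For $r\ge2$, this last polynomial has exactly $\lfloor r/2\rfloor$ distinct negative real zeros.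
   Context: $q$-Zeta numerator: let $P$ be a finite graded poset with a unique maximum and rank function $\rho:P\to\{0,\dots,H\}$, where $H$ is the maximal rank. For $m\ge 0$ put $A_m(P,\rho;q)=\sum_{x_1\le\cdots\le x_m}q^{\rho(x_1)+\cdots+\rho(x_m)}$ (sum over weak chains in $P$; $A_0=1$). The numerator $\mathbb{H}_{P,\rho}(q,t)$ is the polynomial determined by $\sum_{m\ge 0}A_m(P,\rho;q)t^m=\mathbb{H}_{P,\rho}(q,t)/\prod_{a=0}^{H}(1-q^at)$. Type $A_r$: the positive roots are $e_i-e_{j+1}$, $1\le i\le j\le r$, with simple roots $e_i-e_{i+1}$, $1\le i\le r$. Order: $\alpha\le\beta$ iff $\beta-\alpha$ is a nonnegative integer combination of simple roots. Height is the sum of simple-root coefficients. For a word $w=w_1\cdots w_m$ in $\{L,R\}$, $D(w)=\{j: w_j=L\text{ and }(j=1\text{ or }w_{j-1}=R)\}$ (for $r=1$ the only word is empty). $\genfrac{[}{]}{0pt}{}{N}{k}_q$ is the Gaussian binomial coefficient, equal to $0$ unless $0\le k\le N$. *)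

(* Defs.v *)
From HB Require Import structures.
From mathcomp Require Import all_boot all_order all_algebra.
From mathcomp Require Import boolp classical_sets reals.
From mathcomp Require Import complex.
From mathcomp Require Import zify ring.

Set Implicit Arguments.
Unset Strict Implicit.
Unset Printing Implicit Defensive.

Import Order.TTheory GRing.Theory Num.Theory.
Local Open Scope ring_scope.

(* Polynomials in q are {poly int}.  Polynomials in t over them are
   {poly {poly int}}: the outer 'X is t and the inner one is q. *)

Section QZeta.
Variables (d : Order.disp_t) (P : finPOrderType d) (rho : P -> nat).

Definition chain_enum (m : nat) : {poly int} :=
  \sum_(x : m.-tuple P | sorted <=%O x) 'X^(\sum_(y <- x) rho y).

Definition max_rank : nat := \max_(x : P) rho x.

Definition qzeta_denom : {poly {poly int}} :=
  \prod_(a < max_rank.+1) (1 - ('X^a : {poly int}) *: 'X).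

(* (sum_m A_m t^m) * prod_a (1 - q^a t) = h in Z[q][[t]], i.e. the Cauchy
   product of the two coefficient sequences is that of h. *)
Definition is_qzeta_numerator (h : {poly {poly int}}) : Prop :=
  forall n, h`_n = \sum_(i < n.+1) qzeta_denom`_i * chain_enum (n - i).

(* The junk value 0 (no such polynomial) satisfies none of the intended
   identities, since a genuine numerator has constant coefficient 1. *)
Definition qzeta_numerator : {poly {poly int}} :=
  xget 0 [set h | is_qzeta_numerator h].

Lemma is_qzeta_numerator_uniq h h' :
  is_qzeta_numerator h -> is_qzeta_numerator h' -> h = h'.
Proof. by move=> hP h'P; apply/polyP => n; rewrite hP h'P. Qed.

Lemma qzeta_numeratorE h : is_qzeta_numerator h -> qzeta_numerator = h.
Proof.
move=> hP; apply: xget_unique => // h' h'P.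
exact: is_qzeta_numerator_uniq h'P hP.
Qed.

End QZeta.

Section SimpleRoots.
Variable r : nat.
Implicit Types (i j k : 'I_r).

Definition basis_vec (l : 'I_r.+1) : 'rV[int]_r.+1 := delta_mx 0 l.

(* With 0-based indices i, j : 'I_r, this is the root e_i - e_(j+1). *)
Definition root_of i j : 'rV[int]_r.+1 :=
  basis_vec (widen_ord (leqnSn r) i) - basis_vec (lift ord0 j).

Definition simple_root i : 'rV[int]_r.+1 := root_of i i.

Definition prefix_sum (v : 'rV[int]_r.+1) (m : nat) : int :=
  \sum_(l < r.+1 | (l <= m)%N) v 0 l.

Lemma prefix_sumD u v m :
  prefix_sum (u + v) m = prefix_sum u m + prefix_sum v m.
Proof. by rewrite -big_split /=; apply: eq_bigr => l _; rewrite mxE. Qed.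

Lemma prefix_sum_comb (c : 'I_r -> nat) m :
  prefix_sum (\sum_k simple_root k *+ c k) m =
  \sum_k prefix_sum (simple_root k) m *+ c k.
Proof.
rewrite /prefix_sum (eq_bigr (fun l => \sum_k (simple_root k *+ c k) 0 l)).
  rewrite exchange_big /=; apply: eq_bigr => k _.
  by rewrite -sumrMnl; apply: eq_bigr => l _; rewrite mulmxnE.
by move=> l _; rewrite summxE.
Qed.

Lemma prefix_sum_basis (l : 'I_r.+1) m :
  prefix_sum (basis_vec l) m = (l <= m)%N%:R.
Proof.
rewrite /prefix_sum /basis_vec.
case: (boolP (l <= m)%N) => lm.
  rewrite (bigD1 l) //= mxE !eqxx big1 ?addr0 // => x /andP[_ xl].
  by rewrite mxE eqxx (negbTE xl).
rewrite big1 // => x xm; rewrite mxE eqxx /=.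
by case: eqP => // xl; rewrite xl (negbTE lm) in xm.
Qed.

Lemma prefix_sum_root i j m :
  prefix_sum (root_of i j) m = (i <= m)%N%:R - (j < m)%N%:R.
Proof.
have -> : prefix_sum (root_of i j) m =
  prefix_sum (basis_vec (widen_ord (leqnSn r) i)) m
  - prefix_sum (basis_vec (lift ord0 j)) m.
  rewrite /prefix_sum /root_of -sumrB.
  by apply: eq_bigr => l _; rewrite mxE [(- _ : 'M_(_, _)) _ _]mxE.
by rewrite !prefix_sum_basis /= /bump leq0n add1n.
Qed.

Lemma prefix_sum_simple_comb (c : 'I_r -> nat) k :
  prefix_sum (\sum_i simple_root i *+ c i) k = (c k)%:R.
Proof.
rewrite prefix_sum_comb (bigD1 k) //= big1 ?addr0 => [|i ik].
  by rewrite prefix_sum_root leqnn ltnn subr0.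
rewrite prefix_sum_root leq_eqVlt.
by rewrite (inj_eq val_inj) (negbTE ik) subrr mul0rn.
Qed.

Lemma simple_comb_inj (c c' : 'I_r -> nat) :
  \sum_i simple_root i *+ c i = \sum_i simple_root i *+ c' i -> c =1 c'.
Proof.
move=> e k; have := congr1 (fun v => prefix_sum v k) e.
by rewrite !prefix_sum_simple_comb; lia.
Qed.

End SimpleRoots.

(* The pair (i, j) with i <= j stands for the positive root root_of i j. *)
Definition posroot (r : nat) : Type := {p : 'I_r * 'I_r | (p.1 <= p.2)%N}.

HB.instance Definition _ r :=
  SubFinite.copy (posroot r) {p : 'I_r * 'I_r | (p.1 <= p.2)%N}.

Definition root_vec r (a : posroot r) : 'rV[int]_r.+1 :=
  root_of (val a).1 (val a).2.

(* root_vec_simple and simple_comb_inj: these are the coordinates of a in the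
   simple roots. *)
Definition simple_coef r (a : posroot r) (k : 'I_r) : nat :=
  ((val a).1 <= k <= (val a).2)%N.

Definition root_le r (a b : posroot r) : bool :=
  `[< exists c : 'I_r -> nat,
      root_vec b - root_vec a = \sum_k simple_root k *+ c k >].

Definition root_height r (a : posroot r) : nat := (\sum_k simple_coef a k)%N.

Definition root_rank r (a : posroot r) : nat := (root_height a).-1.

Section RootPoset.
Variable r : nat.
Implicit Types a b : posroot r.

Lemma root_of_simple (i j : 'I_r) : (i <= j)%N ->
  root_of i j = \sum_k simple_root k *+ (i <= k <= j)%N.
Proof.
move=> ij; pose f (n : nat) := basis_vec (inord n : 'I_r.+1).
have fE (k : 'I_r) : simple_root k = f k - f k.+1.
  rewrite /simple_root /root_of /f; congr (basis_vec _ - basis_vec _);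
    apply/val_inj; rewrite /= inordK ?ltnS ?(ltnW (ltn_ord k)) //.
have fE2 : root_of i j = f i - f j.+1.
  rewrite /root_of /f; congr (basis_vec _ - basis_vec _);
    apply/val_inj; rewrite /= inordK ?ltnS ?(ltnW (ltn_ord _)) //.
under eq_bigr do rewrite fE mulrb.
rewrite -big_mkcond /= -(big_mkord (fun k => (i <= k <= j)%N)
  (fun k => f k - f k.+1)) fE2.
rewrite big_mkcond /= (big_cat_nat (n := i)) //=; last exact: ltnW.
rewrite [X in _ = X + _]big_nat [X in _ = X + _]big1 ?add0r; last first.
  by move=> k /andP[_ ki]; rewrite leqNgt ki.
rewrite (big_cat_nat (n := j.+1)) //=; last exact: leqW.
rewrite [X in _ = _ + X]big_nat [X in _ = _ + X]big1 ?addr0; last first.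
  by move=> k /andP[jk _]; rewrite [(k <= j)%N]leqNgt jk andbF.
rewrite big_nat.
under eq_bigr => k /andP[ik kj] do rewrite ik -ltnS kj.
by rewrite -big_nat -opprB -telescope_sumr ?leqW // -sumrN;
  apply: eq_bigr => k _; rewrite opprB.
Qed.

Lemma root_vec_simple a :
  root_vec a = \sum_k simple_root k *+ simple_coef a k.
Proof. exact: root_of_simple (valP a). Qed.

Lemma root_leE a b :
  root_le a b = ((val b).1 <= (val a).1)%N && ((val a).2 <= (val b).2)%N.
Proof.
case: a b => [[i j] /= ij] [[i' j'] /= ij'].
apply/asboolP/idP => /=; last first.
  move=> /andP[ii jj]; pose a : posroot r := exist _ (i, j) ij.
  pose b : posroot r := exist _ (i', j') ij'.
  exists (fun k => (simple_coef b k - simple_coef a k)%N).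
  rewrite !root_vec_simple -sumrB; apply: eq_bigr => k _.
  rewrite mulrnBr // /simple_coef /=; lia.
move=> [c]; rewrite !root_vec_simple -/(simple_coef _) => /eqP.
rewrite subr_eq -big_split /=.
under [X in _ == X]eq_bigr do rewrite -mulrnDr.
move=> /eqP/simple_comb_inj h.
move: (h i) (h j); rewrite /simple_coef /=; lia.
Qed.

Lemma root_le_refl : reflexive (@root_le r).
Proof. by move=> a; rewrite root_leE !leqnn. Qed.

Lemma root_le_anti : antisymmetric (@root_le r).
Proof.
move=> a b; rewrite !root_leE => h; apply/val_inj.
rewrite [val a]surjective_pairing [val b]surjective_pairing.
by move: h; case: (val a) (val b) => [i j] [i2 j2] /= /andP[/andP[? ?] /andP[? ?]]; congr (_, _); apply/val_inj => /=; apply/eqP; rewrite eqn_leq; apply/andP.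
Qed.

Lemma root_le_trans : transitive (@root_le r).
Proof.
move=> b a c; rewrite !root_leE => /andP[ba ab] /andP[cb bc].
by rewrite (leq_trans cb ba) (leq_trans ab bc).
Qed.

End RootPoset.

Fact posroot_display : Order.disp_t. Proof. exact: Order.Disp tt tt. Qed.

HB.instance Definition _ r := Order.Le_isPOrder.Build posroot_display
  (posroot r) (@root_le_refl r) (@root_le_anti r) (@root_le_trans r).

Section RootPosetGraded.
Variable r : nat.
Implicit Types a b : posroot r.

Lemma posroot_leP a b :
  reflect (exists c : 'I_r -> nat,
             root_vec b - root_vec a = \sum_k simple_root k *+ c k) (a <= b)%O.
Proof. exact: asboolP. Qed.

Lemma posroot_leE a b :
  (a <= b)%O = ((val b).1 <= (val a).1)%N && ((val a).2 <= (val b).2)%N.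
Proof. exact: root_leE. Qed.

Lemma root_vec_inj : injective (@root_vec r).
Proof.
move=> a b ab; apply: le_anti; apply/andP.
by split; apply/posroot_leP; exists (fun=> 0%N);
  rewrite ab subrr big1 // => k _; rewrite mulr0n.
Qed.

Lemma root_rankE a : root_rank a = ((val a).2 - (val a).1)%N.
Proof.
case: a => [[i j] /= ij]; rewrite /root_rank /root_height /simple_coef /=.
rewrite -(big_mkord xpredT (fun k => nat_of_bool (i <= k <= j)%N)) /=.
rewrite (big_cat_nat (n := i)) //=; last exact: ltnW.
rewrite [X in (X + _)%N]big_nat [X in (X + _)%N]big1 ?add0n; last first.
  by move=> k /andP[_ ki]; rewrite leqNgt ki.
rewrite (big_cat_nat (n := j.+1)) //=; last exact: leqW.
rewrite [X in (_ + X)%N]big_nat [X in (_ + X)%N]big1 ?addn0; last first.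
  by move=> k /andP[jk _]; rewrite [(k <= j)%N]leqNgt jk andbF.
rewrite big_nat (eq_bigr (fun=> 1%N)) => [|k /andP[ik kj]].
  by rewrite -big_nat sum_nat_const_nat muln1 subSn.
by rewrite ik -ltnS kj.
Qed.

(* root_rank is a grading of the root poset: 0 on minimal elements, and
   increasing by 1 along covering relations. *)
Lemma root_rank_min a : (forall b, (b <= a)%O -> b = a) -> root_rank a = 0%N.
Proof.
move=> amin; pose b : posroot r := exist _ ((val a).1, (val a).1) (leqnn _).
have ba : b = a by apply: amin; rewrite posroot_leE /= leqnn (valP a).
by rewrite root_rankE -ba /= subnn.
Qed.

Lemma root_rank_cover a b : (a < b)%O ->
  (forall c, (a <= c)%O -> (c <= b)%O -> c = a \/ c = b) ->
  root_rank b = (root_rank a).+1.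
Proof.
case: a b => [[i j] /= ij] [[i' j'] /= ij'].
set a : posroot r := exist _ (i, j) ij; set b : posroot r := exist _ (i', j') ij'.
move=> lt_ab cov; have := ltW lt_ab; rewrite posroot_leE /= => /andP[ii jj].
rewrite !root_rankE /=.
have [ltii|geii] := ltnP i' i.
  have lt1 : (i.-1 < r)%N by apply: leq_ltn_trans (leq_pred i) _.
  have cP : ((Ordinal lt1, j).1 <= (Ordinal lt1, j).2)%N by rewrite /=; lia.
  pose c : posroot r := exist _ (Ordinal lt1, j) cP.
  case: (cov c); rewrite ?posroot_leE /=; try lia.
    by move=> /(congr1 (fun x => val (val x).1)) /=; lia.
  move=> cb; have := congr1 (fun x => val (val x).1) cb.
  by have := congr1 (fun x => val (val x).2) cb => /=; lia.
have [ltjj|gejj] := ltnP j j'; last first.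
  by move: lt_ab; rewrite lt_neqAle => /andP[/eqP[]]; apply/le_anti;
    rewrite !posroot_leE /= ii jj geii gejj.
have lt1 : (j.+1 < r)%N by apply: leq_ltn_trans ltjj _.
have cP : ((i, Ordinal lt1).1 <= (i, Ordinal lt1).2)%N by rewrite /=; lia.
pose c : posroot r := exist _ (i, Ordinal lt1) cP.
case: (cov c); rewrite ?posroot_leE /=; try lia.
  by move=> /(congr1 (fun x => val (val x).2)) /=; lia.
move=> cb; have := congr1 (fun x => val (val x).1) cb.
by have := congr1 (fun x => val (val x).2) cb => /=; lia.
Qed.

End RootPosetGraded.

Lemma posroot_max r (i0 := ord0 : 'I_r.+1) (im := ord_max : 'I_r.+1)
    (m := exist _ (i0, im) isT : posroot r.+1) (a : posroot r.+1) : (a <= m)%O.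
Proof. by rewrite posroot_leE /= -ltnS ltn_ord. Qed.

(* Satisfies the q-Pascal rule; see gbinom_prod for the quotient formula. *)
Fixpoint gbinom (N k : nat) : {poly int} :=
  match N, k with
  | _, 0 => 1
  | 0, _.+1 => 0
  | N'.+1, k'.+1 => gbinom N' k' + 'X^(k'.+1) * gbinom N' k'.+1
  end.

Lemma gbinom_prod N k :
  gbinom N k * \prod_(i < k) (1 - 'X^(i.+1)) = \prod_(i < k) (1 - 'X^(N - i)).
Proof.
elim: N k => [|N IH] [|k] /=.
- by rewrite !big_ord0 mulr1.
- by rewrite mul0r big_ord_recl /= expr0 subrr mul0r.
- by rewrite !big_ord0 mulr1.
rewrite mulrDl -mulrA IH big_ord_recr /= mulrA IH.
rewrite big_ord_recr /= [RHS]big_ord_recl /= subn0.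
under [in RHS]eq_bigr do rewrite /bump /= add1n subSS.
have [kN|Nk] := leqP k N; last first.
  by rewrite (bigD1 (Ordinal Nk)) //= subnn expr0 subrr !(mul0r, mulr0) addr0.
have -> : 'X^(N.+1) = 'X^(k.+1) * 'X^(N - k) :> {poly int}.
  by rewrite -exprD; congr ('X^ _); lia.
by ring.
Qed.

Inductive letter := L | R.

Definition bool_of_letter (x : letter) := if x is L then true else false.
Definition letter_of_bool (b : bool) := if b then L else R.
Lemma bool_of_letterK : cancel bool_of_letter letter_of_bool.
Proof. by case. Qed.
HB.instance Definition _ := Finite.copy letter (can_type bool_of_letterK).

(* Positions are 0-based: i : 'I_n stands for j = i + 1, so that the weight
   j - 1 is i. *)
Definition Dset n (w : n.-tuple letter) : {set 'I_n} :=
  [set i : 'I_n | (tnth w i == L) &&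
                  ((i == 0 :> nat) || (nth L w i.-1 == R))].

(* Main.v *)
Require Import Defs.
From HB Require Import structures.
From mathcomp Require Import all_boot all_order all_algebra.
From mathcomp Require Import reals complex trigo.
From mathcomp Require Import zify ring lra.

Set Implicit Arguments.
Unset Strict Implicit.
Unset Printing Implicit Defensive.

Import Order.TTheory GRing.Theory Num.Theory.
Local Open Scope ring_scope.

(* An interval with r points has r - l subintervals with l + 1 points, and
   subtracting the resulting recursion twice gives, for the chain series G_r,
     (1 - q^(r+1) t) G_(r+2) = 2 G_(r+1) - G_r,
   with G_0 = 1 for the empty poset.  Clearing denominators, the numerators
   satisfy N_(r+2) = 2 N_(r+1) - (1 - q^r t) N_r with N_0 = N_1 = 1.  Splitting
   words by their last letter, and differencing the q-binomial convolution once
   in each factor, shows that the two explicit formulas obey the same recursion.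
   At q = 1 it becomes that of ((1 + s)^r + (1 - s)^r) / 2 with s^2 = t, and of
   cos(r x) / cos(x)^r at t = - tan(x)^2, which locates the roots. *)

(** * Weighted chains in a poset and among subintervals *)

Section Chains.
Variables (d : Order.disp_t) (P : finPOrderType d) (rho : P -> nat).

(* Weighted chains of length m below z, listed from the top. *)
Fixpoint down_enum (m : nat) (z : P) : {poly int} :=
  if m is m'.+1 then \sum_(y | (y <= z)%O) 'X^(rho y) * down_enum m' y else 1.

Lemma down_enumE m z : down_enum m z =
  \sum_(x : m.-tuple P | path >=%O z x) 'X^(\sum_(y <- x) rho y).
Proof.
elim: m z => [|m IHm] z /=.
  rewrite (big_pred1 [tuple]) ?big_nil // => x.
  by rewrite [x]tuple0 /= eqxx.
rewrite (reindex (fun p : P * m.-tuple P => [tuple of p.1 :: p.2])) /=; last first.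
  exists (fun x => (thead x, [tuple of behead x])) => [[y x] _ | x _] /=.
    by rewrite theadE; congr (_, _); apply/val_inj.
  by rewrite -tuple_eta.
rewrite -(pair_big_dep (fun y => (y <= z)%O) (fun y (x : m.-tuple P) => path >=%O y x)
  (fun y (x : m.-tuple P) => 'X^(\sum_(u <- y :: x) rho u))) /=.
apply: eq_bigr => y _; rewrite IHm big_distrr /=.
by apply: eq_bigr => x _; rewrite big_cons exprD.
Qed.

(** Reversal turns an increasing chain into a descending path, and starting that path at the maximum
    constrains nothing. *)
Lemma chain_enum_down m top :
  (forall x, (x <= top)%O) -> chain_enum rho m = down_enum m top.
Proof.
move=> topP; rewrite down_enumE /chain_enum.
rewrite (reindex_inj (h := fun x : m.-tuple P => [tuple of rev x])) /=; last first.
  by move=> x y /(congr1 val)/(can_inj revK)/val_inj.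
apply: eq_big => [x|x _].
  by rewrite rev_sorted; case: x => [[|y x] _] //=; rewrite topP.
by congr ('X^_); apply: perm_big; rewrite perm_rev.
Qed.

End Chains.

(** Induction on [j - i]: the subintervals that start at the left end contribute each length once,
    and the others form the previous case shifted by one. *)
Lemma sum_subinterval (V : nmodType) (f : nat -> V) i j : (i <= j)%N ->
  \sum_(i <= a < j.+1) \sum_(a <= b < j.+1) f (b - a)%N =
  \sum_(l < (j - i).+1) f l *+ ((j - i).+1 - l).
Proof.
move=> ij; rewrite -{1 2}(subnK ij); move: (j - i)%N => n {j ij}.
elim: n => [|n IHn].
  by rewrite add0n !big_nat1 subnn big_ord1.
rewrite big_ltn; last by lia.
rewrite (_ : \sum_(i.+1 <= _ < _) _ = \sum_(i <= a < (n + i).+1) \sum_(a <= b < (n + i).+1) f (b - a)%N); last first.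
  rewrite big_add1 /=; apply: eq_bigr => a _; rewrite big_add1 /=.
  by apply: eq_bigr => b _; rewrite subSS.
rewrite IHn -[X in \sum_(X <= _ < _) _]add0n big_addn.
rewrite (_ : (n.+1 + i).+1 - i = n.+2)%N; last by lia.
rewrite big_mkord big_ord_recr [in RHS]big_ord_recr /= addrAC.
congr (_ + _); last by rewrite addnK subSnn mulr1n.
rewrite -big_split /=; apply: eq_bigr => l _.
by rewrite addnK -mulrS; congr (_ *+ _); have := ltn_ord l; lia.
Qed.

(* Chains of length m among the subintervals of an interval with r points. *)
Fixpoint interval_enum (m r : nat) : {poly int} :=
  if m is m'.+1 then
    \sum_(l < r) ('X^l * interval_enum m' l.+1) *+ (r - l)
  else 1.

(** The roots below [z] are the subintervals of the interval [z], so the count depends only on the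
    rank of [z]. *)
Lemma down_enum_posroot r m (z : posroot r) :
  down_enum (@root_rank r) m z = interval_enum m (root_rank z).+1.
Proof.
elim: m z => [//|m IHm] z /=.
under eq_bigr do rewrite IHm.
pose f l : {poly int} := 'X^l * interval_enum m l.+1.
rewrite -(@eq_bigr _ _ _ _ _ _ (fun y => f (root_rank y))) // root_rankE.
rewrite -(sum_subinterval f (valP z)).
case: z => [[i j] /= ij].
transitivity (\sum_(p : 'I_r * 'I_r | [&& (i <= p.1)%N, (p.1 <= p.2)%N & (p.2 <= j)%N]) f (p.2 - p.1)%N).
  rewrite (reindex_omap (val : posroot r -> _) insub) /=.
    apply: eq_big => y; last by rewrite root_rankE.
    by have /= yP := valP y; rewrite posroot_leE /= yP valK eqxx andbT.
  by move=> p /and3P[_ pp _]; rewrite (insubT (fun p : 'I_r * 'I_r => (p.1 <= p.2)%N) pp).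
rewrite -(pair_big_dep (fun a : 'I_r => (i <= a)%N)
   (fun a b : 'I_r => (a <= b)%N && (b <= j)%N) (fun a b => f (b - a)%N)) /=.
have jr : (j.+1 <= r)%N by [].
have E (F : nat -> {poly int}) (a : nat) :
    \sum_(b < r | (a <= b)%N && (b <= j)%N) F b = \sum_(a <= b < j.+1) F b.
  rewrite -(big_mkord (fun b => (a <= b)%N && (b <= j)%N)).
  rewrite [RHS](big_nat_widen _ _ _ _ _ jr) [RHS](big_nat_widenl _ 0) //.
  by apply: eq_bigl => b; rewrite ltnS andbC.
under eq_bigr do rewrite (E (fun b => f (b - _)%N)).
pose F a := \sum_(a <= b < j.+1) f (b - a)%N.
rewrite -(E F) /= [RHS]big_mkcondr /=.
apply: eq_bigr => a _; case: leqP => // ja.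
by rewrite /F big_geq.
Qed.

Lemma chain_enum_posroot r m :
  chain_enum (@root_rank r.+1) m = interval_enum m r.+1.
Proof.
rewrite (chain_enum_down _ _ (@posroot_max r)) down_enum_posroot root_rankE /=.
by rewrite subn0.
Qed.

Lemma max_rank_posroot r : max_rank (@root_rank r.+1) = r.
Proof.
apply/eqP; rewrite eqn_leq; apply/andP; split.
  apply/bigmax_leqP => x _; rewrite root_rankE.
  exact: leq_trans (leq_subr _ _) (leq_ord _).
pose m : posroot r.+1 := exist _ (ord0, ord_max) isT.
by apply: leq_trans (leq_bigmax m); rewrite root_rankE /= subn0.
Qed.

(* The numerator for r = n (for n = 0, that of the empty poset). *)
Fixpoint numer (S : comNzRingType) (q : S) (n : nat) {struct n} : {poly S} :=
  match n with
  | 0 => 1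
  | n1.+1 => match n1 with
    | 0 => 1
    | n2.+1 => numer q n1 *+ 2 - (1 - q ^+ n2 *: 'X) * numer q n2
    end
  end.

Lemma numerSS (S : comNzRingType) (q : S) n :
  numer q n.+2 = numer q n.+1 *+ 2 - (1 - q ^+ n *: 'X) * numer q n.
Proof. by []. Qed.

Lemma nat_ind2 (Q : nat -> Prop) :
  Q 0%N -> Q 1%N -> (forall n, Q n -> Q n.+1 -> Q n.+2) -> forall n, Q n.
Proof.
move=> Q0 Q1 QS n; suff: Q n /\ Q n.+1 by case.
by elim: n => [|n [? ?]]; split=> //; apply: QS.
Qed.

(** Serves both to specialize q to 1 and to move integer coefficients into another ring. *)
Lemma map_numer (S T : comNzRingType) (f : {rmorphism S -> T}) (q : S) n :
  map_poly f (numer q n) = numer (f q) n.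
Proof.
elim/nat_ind2: n => [||n IH0 IH1]; rewrite ?rmorph1 //.
rewrite !numerSS rmorphB rmorphM rmorphMn rmorphB /= rmorph1 map_polyZ /=.
by rewrite map_polyX rmorphXn IH0 IH1.
Qed.

Lemma coef_lin_mul (S : comNzRingType) (c : S) (p : {poly S}) i :
  ((1 - c *: 'X) * p)`_i = p`_i - c * (if i is i'.+1 then p`_i' else 0).
Proof.
rewrite mulrBl mul1r coefB -scalerAl coefZ coefXM.
by case: i.
Qed.

(** * Truncated chain series and their denominators *)

Section Series.

Lemma interval_enum_rec m r :
  interval_enum m.+1 r.+2 + interval_enum m.+1 r =
  interval_enum m.+1 r.+1 *+ 2 + 'X^(r.+1) * interval_enum m r.+2.
Proof.
pose f l := 'X^l * interval_enum m l.+1.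
(* The multiplicities [n - l] are linear in [n]: the first difference in [n] is a plain sum, and the
   second is a single term. *)
have ieS n : interval_enum m.+1 n.+1 = interval_enum m.+1 n + \sum_(l < n.+1) f l.
  rewrite /= !big_ord_recr /= addrA -big_split /= subSnn; congr (_ + _).
  by apply: eq_bigr => l _; rewrite subSn ?mulrSr // ltnW.
rewrite !ieS -/(f r.+1) [\sum_(l < r.+2) _]big_ord_recr /=.
by ring.
Qed.

Variable M : nat.
(** Series are cut after t^M to stay within polynomials; identities then hold up to an explicit
    multiple of t^(M+1). *)
Let G r : {poly {poly int}} := \poly_(m < M.+1) interval_enum m r.
Let D r : {poly {poly int}} := \prod_(a < r) (1 - ('X^a : {poly int}) *: 'X).

Let G_rec r : exists E,
  (1 - ('X^(r.+1) : {poly int}) *: 'X) * G r.+2 = G r.+1 *+ 2 - G r + 'X^(M.+1) * E.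
Proof.
(* The only overflow is the top term of [G r.+2] multiplied by - q^(r+1) t. *)
exists (- ('X^(r.+1) * interval_enum M r.+2)%:P).
apply/polyP => i; rewrite coef_lin_mul !coefE.
case: i => [|i] /=; first by ring.
rewrite ?coef_poly ?ltnS ?subSS.
have [iM|Mi|->] := ltngtP i M.
- have /eqP := interval_enum_rec i r; rewrite -subr_eq => /eqP.
  by rewrite -!/(interval_enum _.+1 _) => e; rewrite /= in e *; rewrite -e; ring.
- by rewrite subn_eq0 leqNgt Mi /=; ring.
- by rewrite subnn /= ; ring.
Qed.

Lemma denom_series r : exists E, D r * G r = numer 'X r + 'X^(M.+1) * E.
Proof.
elim/nat_ind2: r => [||r [E0 IH0] [E1 IH1]].
- exists 0; rewrite mulr0 addr0 /D big_ord0 mul1r.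
  apply/polyP => -[|i]; rewrite coef_poly coef1 //=.
  by rewrite big_ord0 if_same.
- exists (- 1); rewrite /D big_ord1 expr0.
  have e i : interval_enum i 1 = 1.
    by elim: i => //= i IHi; rewrite big_ord1 IHi expr0 mulr1.
  apply/polyP => i; rewrite coef_lin_mul !coefE.
  case: i => [|i] /=; first by rewrite mulr0 subr0 addr0.
  rewrite ?coef_poly ?ltnS ?subSS !e.
  rewrite -/(interval_enum i.+1 1) e.
  have [iM|Mi|->] := ltngtP i M; rewrite ?subnn //=.
  + by ring.
  + by rewrite subn_eq0 leqNgt Mi /=; ring.
  + by ring.
have [E2 HE] := G_rec r.
exists (E1 *+ 2 - (1 - ('X^r : {poly int}) *: 'X) * E0 + D r.+1 * E2).
have DS n : D n.+1 = D n * (1 - ('X^n : {poly int}) *: 'X) by rewrite /D big_ord_recr.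
rewrite DS -mulrA HE numerSS mulrDr mulrBr mulrnAr IH1.
(* The last factor 1 - q^r t of [D r.+1] is kept aside: it is the factor of [numer 'X r] in the
   recursion. *)
rewrite {1}DS -mulrA [_ * G r]mulrC mulrA IH0.
by ring.
Qed.

End Series.

Lemma numer_is_qzeta r : is_qzeta_numerator (@root_rank r.+1) (numer 'X r.+1).
Proof.
(* Truncation at order n suffices, as the error starts at t^(n+1). *)
move=> n; have [E HE] := denom_series n r.+1.
rewrite (_ : (numer _ _)`_n = (numer 'X r.+1 + 'X^(n.+1) * E)`_n); last first.
  by rewrite coefD coefXnM ltnSn addr0.
rewrite -HE coefM /qzeta_denom max_rank_posroot; apply: eq_bigr => i _.
by rewrite coef_poly ltnS leq_subr chain_enum_posroot.
Qed.

(** * Generating function of words, by last letter *)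

Section Words.

Lemma big_tuple_rcons (V : nmodType) (T : finType) n (F : n.+1.-tuple T -> V) :
  \sum_w F w = \sum_(x : T) \sum_(w : n.-tuple T) F [tuple of rcons w x].
Proof.
rewrite pair_bigA /= (reindex (fun p : T * n.-tuple T => [tuple of rcons p.2 p.1])) //=.
apply: onW_bij; apply: inj_card_bij => [[x w] [y v] /(congr1 val)/= |].
  by move/rcons_inj => [/val_inj-> ->].
by rewrite card_prod !card_tuple expnS.
Qed.

Lemma big_letter (V : nmodType) (F : letter -> V) : \sum_x F x = F L + F R.
Proof.
rewrite (reindex letter_of_bool) ?big_bool //=.
by exists bool_of_letter => -[].
Qed.

Let wt n (w : n.-tuple letter) : {poly {poly int}} :=
  ('X^(\sum_(i in Dset w) i) : {poly int}) *: 'X^#|Dset w|.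

Let is_descent (s : seq letter) (i : nat) : bool :=
  (nth L s i == L) && ((i == 0%N) || (nth L s i.-1 == R)).

Let wtE n (w : n.-tuple letter) :
  wt w = \prod_(i < n | is_descent w i) (('X^i : {poly int}) *: 'X).
Proof.
rewrite /wt -prodrXr -scaler_prodr; apply: eq_bigl => i.
by rewrite inE (tnth_nth L).
Qed.

(** An appended letter leaves the status of earlier positions unchanged. The default [R] in
    [last R w] makes a first letter [L] count, as [Dset] requires at position 0. *)
Let wt_rcons n (w : n.-tuple letter) x :
  wt [tuple of rcons w x] =
  wt w * (if (x == L) && (last R w == R) then ('X^n : {poly int}) *: 'X else 1).
Proof.
rewrite !wtE big_mkcond big_ord_recr /= [in RHS]big_mkcond /=; congr (_ * _).
  apply: eq_bigr => i _; congr (if _ then _ else _).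
  by rewrite /is_descent !nth_rcons size_tuple ltn_ord (leq_ltn_trans (leq_pred i)).
rewrite /is_descent !nth_rcons size_tuple ltnn eqxx.
congr (if _ && _ then _ else _).
case: n w => [|n] w /=; first by rewrite [w]tuple0.
rewrite ltnSn -[n in nth _ _ n]/(n.+1.-1) -{2}(size_tuple w) nth_last.
by case: (tupleP w).
Qed.

Let W n x := \sum_(w : n.-tuple letter | last R w == x) wt w.

Let W_total n : \sum_(w : n.-tuple letter) wt w = W n L + W n R.
Proof.
rewrite (bigID (fun w : n.-tuple letter => last R w == L)) /=; congr (_ + _).
by apply: eq_bigl => w; case: (last R w).
Qed.

Let W_R n : W n.+1 R = W n L + W n R.
Proof.
rewrite /W big_mkcond big_tuple_rcons big_letter /= -W_total.
rewrite big1 ?add0r => [|w _]; last by rewrite last_rcons.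
by apply: eq_bigr => w _; rewrite last_rcons eqxx wt_rcons mulr1.
Qed.

Let W_L n : W n.+1 L = W n L + (('X^n : {poly int}) *: 'X) * W n R.
Proof.
rewrite /W big_mkcond big_tuple_rcons big_letter /= addrC.
rewrite big1 ?add0r => [|w _]; last by rewrite last_rcons.
rewrite mulr_sumr [X in _ = X + _]big_mkcond [X in _ = _ + X]big_mkcond -big_split.
apply: eq_bigr => w _; rewrite last_rcons eqxx wt_rcons /=.
by case: (last R w); rewrite /= ?mulr1 ?addr0 // add0r mulrC.
Qed.

Lemma numer_words n :
  numer 'X n.+1 = \sum_(w : n.-tuple letter)
    ('X^(\sum_(i in Dset w) i) : {poly int}) *: 'X^#|Dset w|.
Proof.
(* Appending [R] costs nothing, so the words of length n + 1 ending in [R] carry the total weight at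
   length n; tracking both quantities closes the induction. *)
rewrite W_total; suff: W n R = numer 'X n /\ W n L + W n R = numer 'X n.+1 by case.
elim: n => [|n [IHR IH]].
  have -> : W 0 R = 1.
    by rewrite /W (big_pred1 [tuple]) ?wtE ?big_ord0 // => w; rewrite [w]tuple0 !eqxx.
  have -> : W 0 L = 0 by rewrite /W big_pred0 // => w; rewrite [w]tuple0.
  by rewrite add0r.
rewrite W_R IH; split=> //; rewrite W_L numerSS -IH -IHR.
by ring.
Qed.

Lemma numer_ge0 n k l : 0 <= (numer ('X : {poly int}) n.+1)`_k`_l.
Proof.
rewrite numer_words coef_sum coef_sum; apply: sumr_ge0 => w _.
by rewrite coefZ !coefXn mulr_natr coefMn coefXn -mulrnA ler0n.
Qed.

End Words.

(** * Gaussian binomial convolution *)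

Section Gbinom.

Lemma gbinom0 n : gbinom n 0 = 1. Proof. by case: n. Qed.

Lemma gbinom_small n k : (n < k)%N -> gbinom n k = 0.
Proof.
elim: n k => [|n IHn] [|k] //= nk.
by rewrite !IHn ?mulr0 ?addr0 // ltnW.
Qed.

Lemma gbinom_pascal n k :
  gbinom n.+1 k.+1 = gbinom n k + 'X^(k.+1) * gbinom n k.+1.
Proof. by []. Qed.

(** The dual q-Pascal rule; where [n - k] truncates, [gbinom n k] vanishes. *)
Lemma gbinomS n k :
  gbinom n.+1 k.+1 = gbinom n k.+1 + 'X^(n - k) * gbinom n k.
Proof.
elim: n k => [|n IHn] k; first by rewrite sub0n expr0; case: k => [|k] /=; ring.
rewrite gbinom_pascal {1}(IHn k).
case: k => [|k]; first by rewrite gbinom_pascal !gbinom0 !subn0 (exprS _ n); ring.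
rewrite {1}(IHn k) !gbinom_pascal subSS.
have [kn|nk] := ltnP k n; last by rewrite (@gbinom_small n k.+1) ?ltnS //; ring.
rewrite -(subnSK kn) !(exprS _ (n - _)) !(exprS _ k.+1).
by ring.
Qed.

Let conv (u v : nat -> {poly int}) r := \sum_(i < r.+1) u i * v (r - i)%N.

Let eq_conv u u' v v' r : u =1 u' -> v =1 v' -> conv u v r = conv u' v' r.
Proof. by move=> e e'; apply: eq_bigr => i _; rewrite e e'. Qed.

Let convSr u v r : v 0%N = 0 -> conv u v r.+1 = conv u (v \o succn) r.
Proof.
move=> v0; rewrite /conv big_ord_recr /= subnn v0 mulr0 addr0.
by apply: eq_bigr => i _; rewrite subSn // leq_ord.
Qed.

Let convSl u v r : u 0%N = 0 -> conv u v r.+1 = conv (u \o succn) v r.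
Proof. by move=> u0; rewrite /conv big_ord_recl /= u0 mul0r add0r. Qed.

(** A difference of convolutions can be put on a single factor when that factor vanishes at 0, since
    the extra boundary term is then zero. *)
Let conv_diffr u v r : v 0%N = 0 ->
  conv u v r.+1 - conv u v r = conv u (fun i => v i.+1 - v i) r.
Proof.
move=> v0; rewrite convSr // /conv -sumrB.
by apply: eq_bigr => i _; rewrite -mulrBr.
Qed.

Let conv_diffl u v r : u 0%N = 0 ->
  conv u v r.+1 - conv u v r = conv (fun i => u i.+1 - u i) v r.
Proof.
move=> u0; rewrite convSl // /conv -sumrB.
by apply: eq_bigr => i _; rewrite -mulrBl.
Qed.

Let S k r := conv (gbinom ^~ k) (gbinom ^~ k.+1) r.

(** The left factor is constantly 1, so one difference goes on the right factor; this leaves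
    geometric sums, whose difference is the last power. *)
Let S_diff0 r : S 0 r.+2 - S 0 r.+1 - (S 0 r.+1 - S 0 r) = 'X^(r.+1).
Proof.
rewrite /S !(@conv_diffr (gbinom ^~ 0%N) (gbinom ^~ 1%N) _ erefl).
rewrite !(@eq_conv _ (fun=> 1) _ (fun i => 'X^i)); try by move=> i; rewrite gbinom0.
  by rewrite /conv big_ord_recl /= subn0 mul1r addrK.
all: by move=> i; rewrite gbinomS gbinom0 subn0; ring.
Qed.

(** By [gbinomS], one difference in each factor lowers both lower indices by 1 and yields the powers
    q^(i-k) and q^(j-k-1) with i + j = r. *)
Let S_diff k r :
  'X^(k.+2 * k.+1) * (S k.+1 r.+2 - S k.+1 r.+1 - (S k.+1 r.+1 - S k.+1 r)) =
  'X^(r.+1) * ('X^(k.+1 * k) * S k r).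
Proof.
rewrite /S !(@conv_diffl (gbinom ^~ k.+1) (gbinom ^~ k.+2) _ erefl).
rewrite (@conv_diffr _ (gbinom ^~ k.+2) _ erefl) mulr_sumr mulrA -exprD mulr_sumr.
apply: eq_bigr => i _; rewrite !gbinomS; set j := (r - i)%N.
have rE : r = (i + j)%N by rewrite /j subnKC // leq_ord.
rewrite [_ + _ - _]addrAC subrr add0r [_ + _ * _ - _]addrAC subrr add0r.
(* Outside these ranges both sides vanish; inside them no subtraction truncates and the exponents
   agree. *)
have [ki|ik] := leqP k i; last by rewrite (gbinom_small ik) !(mulr0, mul0r).
have [kj|jk] := leqP k.+1 j; last by rewrite (gbinom_small jk) !(mulr0, mul0r).
rewrite mulrACA !mulrA -!exprD; congr ('X^_ * _ * _).
by nia.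
Qed.

Lemma coef_numer0 n : (numer ('X : {poly int}) n)`_0 = 1.
Proof.
elim/nat_ind2: n => [||n IH0 IH1]; rewrite ?coef1 // numerSS.
by rewrite coefB coefMn coef_lin_mul IH0 IH1 mulr0 subr0; ring.
Qed.

Let coef_numer_S r k :
  (numer ('X : {poly int}) r.+1)`_k.+1 = 'X^(k.+1 * k) * S k r.
Proof.
elim/nat_ind2: r k => [k|k|r IH0 IH1 k].
- by rewrite coef1 /S /conv big_ord1 !mulr0.
- rewrite numerSS coefB coefMn coef_lin_mul expr0 !coef1 mul1r.
  rewrite /S /conv !big_ord_recr big_ord0 /=.
  by case: k => [|k] /=; rewrite ?gbinom0; ring.
rewrite numerSS coefB coefMn coef_lin_mul IH0 IH1.
case: k => [|k].
  by rewrite coef_numer0 muln0 expr0 -(S_diff0 r); ring.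
by rewrite IH0 -(S_diff k r); ring.
Qed.

Lemma coef_numer r k : (numer ('X : {poly int}) r.+1)`_k.+1 =
  'X^(k.+1 * k) * \sum_(i < r.+1) gbinom i k * gbinom (r - i) k.+1.
Proof. exact: coef_numer_S. Qed.

End Gbinom.

(** * Specialization at q = 1 and real roots *)

Section AtOne.

(** Applying Pascal's rule twice gives the recursion for binomials with even lower index. *)
Lemma coef_numer1 (S : comNzRingType) n k :
  (numer (1 : S) n)`_k = 'C(n, 2 * k)%:R.
Proof.
elim/nat_ind2: n k => [k|k|n IH0 IH1 k].
- by rewrite coef1 bin0n; case: k.
- by rewrite coef1; case: k => // k; rewrite bin_small // mulnS.
rewrite numerSS coefB coefMn coef_lin_mul !IH0 IH1 expr1n mul1r.
case: k => [|k]; first by rewrite subr0 !bin0; ring.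
rewrite IH0 (_ : 2 * k.+1 = (2 * k).+2)%N; last by rewrite mulnS.
by rewrite !binS !natrD; ring.
Qed.

Lemma numer1_bin n :
  numer (1 : int) n = \sum_(0 <= k < (n./2).+1) ('C(n, 2 * k)%:R : int) *: 'X^k.
Proof.
apply/polyP => k; rewrite coef_numer1 big_mkord
  -(poly_def _ (fun i => 'C(n, 2 * i)%:R)) coef_poly ltnS.
case: leqP => // nk; rewrite bin_small //.
by rewrite mul2n -ltn_half_double // ltnS.
Qed.

Lemma horner_numer1SS (S : comNzRingType) (y : S) n :
  (numer 1 n.+2).[y] = (numer 1 n.+1).[y] *+ 2 - (1 - y) * (numer 1 n).[y].
Proof. by rewrite numerSS expr1n scale1r !hornerE. Qed.

(** The characteristic equation X^2 = 2 X - (1 - s^2) has roots 1 + s and 1 - s. *)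
Lemma horner_numer1 (F : fieldType) (s : F) n : 2 != 0 :> F ->
  (numer 1 n).[s ^+ 2] = ((1 + s) ^+ n + (1 - s) ^+ n) / 2.
Proof.
move=> F2; elim/nat_ind2: n => [||n IH0 IH1].
- by rewrite hornerC; field.
- by rewrite hornerC; field.
by rewrite horner_numer1SS IH0 IH1 !exprS; field.
Qed.

Variable R : realType.

(** Since 1 + tan(x)^2 = 1 / cos(x)^2, the recursion becomes cos((n+2)x) + cos(n x) = 2 cos(x)
    cos((n+1)x). *)
Lemma horner_numer1_tan (x : R) n : cos x != 0 ->
  (numer 1 n).[- tan x ^+ 2] * cos x ^+ n = cos (n%:R * x).
Proof.
move=> cx; elim/nat_ind2: n => [||n IH0 IH1].
- by rewrite hornerC mulr1 mul0r cos0.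
- by rewrite hornerC !mul1r expr1.
have -> : n.+2%:R * x = n.+1%:R * x + x by rewrite -natr1; ring.
have := cosB (n.+1%:R * x) x.
have -> : n.+1%:R * x - x = n%:R * x by rewrite -natr1; ring.
rewrite cosD -IH0 -IH1 => e.
rewrite horner_numer1SS.
have := cos2_tan2 cx => ct.
have ct1 : (1 + tan x ^+ 2) * cos x ^+ 2 = 1 by rewrite -ct mulVf // expf_neq0.
set a := (numer 1 n.+1).[_] in e *; set b := (numer 1 n).[_] in e *.
transitivity (2 * (a * cos x ^+ n.+1) * cos x - b * cos x ^+ n * ((1 + tan x ^+ 2) * cos x ^+ 2)).
  by rewrite (exprSr (cos x) n.+1) (exprSr (cos x) n); ring.
by rewrite ct1 mulr1 e; ring.
Qed.

Lemma numer1_neq0 n : numer (1 : R) n != 0.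
Proof.
apply/eqP => /(congr1 (fun p : {poly R} => p`_0)) /eqP.
by rewrite coef_numer1 bin0 coef0 oner_eq0.
Qed.

Lemma size_numer1 n : (size (numer (1 : R) n) <= (n./2).+1)%N.
Proof.
apply/leq_sizeP => k nk; rewrite coef_numer1 bin_small //.
by rewrite mul2n -ltn_half_double.
Qed.

(** Angles at which cos(n x) = 0; those with 2k + 1 < n lie strictly between 0 and pi/2. *)
Let theta n k : R := (2 * k + 1)%:R / (2 * n)%:R * pi.

Let theta_itv n k : (2 * k < n.-1)%N -> theta n k \in `](- (pi / 2)), (pi / 2)[.
Proof.
move=> kn; have pi0 := pi_gt0 R; have n0 : 0 < (2 * n)%:R :> R by rewrite ltr0n; lia.
have t0 : 0 < theta n k.
  by rewrite /theta mulr_gt0 // divr_gt0 // ltr0n addn1.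
rewrite in_itv /=; apply/andP; split; first by apply: lt_trans t0; lra.
rewrite /theta mulrC ltr_pM2l // ltr_pdivrMr //.
rewrite natrM mulrA mulVf ?mul1r ?ltr_nat ?pnatr_eq0 //; lia.
Qed.

Lemma cos_odd_pihalf k : cos ((2 * k + 1)%:R * (pi / 2)) = 0 :> R.
Proof.
elim: k => [|k IHk]; first by rewrite muln0 mul1r cos_pihalf.
have -> : (2 * k.+1 + 1)%:R * (pi / 2) = (2 * k + 1)%:R * (pi / 2) + pi :> R.
  by rewrite mulnS -addnA natrD; field.
by rewrite cosDpi IHk oppr0.
Qed.

(** The values - tan(x)^2 at these angles are distinct negative roots, and their number already
    reaches the degree bound. *)
Lemma numer1_negative_roots n : exists s : seq R,
  [/\ uniq s, size s = n./2
    & forall x, (x \in s) = (x < 0) && root (numer 1 n) x].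
Proof.
have half k : (k \in iota 0 n./2) -> (2 * k < n.-1)%N by rewrite mem_iota; lia.
pose f k : R := - tan (theta n k) ^+ 2.
have tan_gt0 k : (2 * k < n.-1)%N -> 0 < tan (theta n k).
  move=> kn; rewrite -(tan0 R) ltr_tan ?theta_itv //.
    by rewrite /theta mulr_gt0 ?pi_gt0 // divr_gt0 // ltr0n; lia.
  by have pi0 := pi_gt0 R; rewrite in_itv /=; apply/andP; split; lra.
have sU : uniq (map f (iota 0 n./2)).
  rewrite map_inj_in_uniq ?iota_uniq // => k l /half kn /half ln /oppr_inj/eqP.
  rewrite eqrXn2 ?ltW ?tan_gt0 // => /eqP /tan_inj.
  move=> /(_ (theta_itv kn) (theta_itv ln)) /mulIf.
  rewrite gt_eqF ?pi_gt0 // => /(_ isT) /divIf.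
  rewrite pnatr_eq0 => /(_ _)/eqP; rewrite eqr_nat; lia.
have sP x : x \in map f (iota 0 n./2) -> (x < 0) && root (numer 1 n) x.
  move=> /mapP[k /half kn ->]; rewrite oppr_lt0 exprn_gt0 ?tan_gt0 //=.
  have cx : 0 < cos (theta n k).
    by apply: cos_gt0_pihalf; have := theta_itv kn; rewrite in_itv.
  have n0 : n%:R != 0 :> R by rewrite pnatr_eq0; lia.
  have := horner_numer1_tan n (lt0r_neq0 cx).
  have -> : n%:R * theta n k = (2 * k + 1)%:R * (pi / 2).
    by rewrite /theta natrM; field.
  by move/eqP; rewrite cos_odd_pihalf mulf_eq0 expf_eq0 (gt_eqF cx) andbF orbF.
exists (map f (iota 0 n./2)); split=> //; first by rewrite size_map size_iota.
move=> x; apply/idP/idP => [|/andP[x0 rx]]; first exact: sP.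
apply/negPn/negP => xs.
have rs : all (root (numer 1 n)) (x :: map f (iota 0 n./2)).
  by rewrite /= rx; apply/allP => y /sP/andP[].
have := max_poly_roots (numer1_neq0 n) rs.
rewrite /= xs sU size_map size_iota => /(_ isT) H.
by have := leq_trans H (size_numer1 n); rewrite ltnn.
Qed.

End AtOne.

(** * Closed forms and zeros for the root poset of type A *)

Theorem corollary5p6 (R : realType) (r : nat) (r_ge1 : (1 <= r)%N) :
  let HH : {poly {poly int}} := qzeta_numerator (@root_rank r) in
  let HH1 : {poly int} := map_poly (horner_eval (1 : int)) HH in
  [/\ is_qzeta_numerator (@root_rank r) HH,
      HH = \sum_(w : (r.-1).-tuple letter)
             ('X^(\sum_(i in Dset w) i) : {poly int}) *: 'X^#|Dset w|,
      (forall k l : nat, 0 <= HH`_k`_l),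
      [/\ (forall k : nat, (1 <= k <= r./2)%N ->
             HH`_k = 'X^(k * (k - 1)) *
               \sum_(k <= h < (r - k).+1)
                  gbinom (h - 1) (k - 1) * gbinom (r - h) k),
          (forall k : nat, (r./2 < k)%N -> HH`_k = 0)
        & HH`_0 = 1]
    & [/\ HH1 = \sum_(0 <= k < (r./2).+1) ('C(r, 2 * k)%:R : int) *: 'X^k,
          (forall z : R[i],
             (map_poly intr HH1).[z] =
               ((1 + sqrtC z) ^+ r + (1 - sqrtC z) ^+ r) / 2)
        & ((2 <= r)%N ->
             exists s : seq R,
               [/\ uniq s, size s = r./2
                 & forall x : R,
                     (x \in s) = (x < 0) && root (map_poly intr HH1) x])]].
Proof.
case: r r_ge1 => // r _ HH HH1.
have HHE : HH = numer 'X r.+1 by exact: qzeta_numeratorE (numer_is_qzeta r).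
have HH1E : HH1 = numer 1 r.+1.
  by rewrite /HH1 HHE map_numer /= /horner_eval hornerX.
have HH1R (S : comNzRingType) : map_poly intr HH1 = numer (1 : S) r.+1.
  by rewrite HH1E map_numer rmorph1.
split; rewrite ?HHE.
- exact: numer_is_qzeta.
- exact: numer_words.
- exact: numer_ge0.
- split; last exact: coef_numer0.
    case=> // k /andP[_ kr]; rewrite coef_numer subn1 /=; congr (_ * _).
    rewrite -(big_mkord xpredT (fun i => gbinom i k * gbinom (r - i) k.+1)).
    rewrite big_add1 /= (_ : (r.+1 - k.+1)%N = (r - k)%N) //.
    (* With i = h - 1, terms with i < k vanish through the first Gaussian binomial and those with i
       >= r - k through the second. *)
    rewrite (big_cat_nat (n := k)) //=; last by lia.
    rewrite [X in X + _]big_nat big1 ?add0r => [|i /andP[_ ik]]; last first.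
      by rewrite gbinom_small ?mul0r.
    rewrite (big_cat_nat (n := (r - k)%N)) //=; [|lia|lia].
    rewrite [X in _ + X]big_nat [X in _ + X]big1 ?addr0 => [|i /andP[ik ir]]; last first.
      by rewrite (@gbinom_small (r - i)%N) ?mulr0 //; lia.
    by apply: eq_bigr => i _; rewrite subn1 subSS.
  case=> // k rk; rewrite coef_numer big1 ?mulr0 // => i _.
  (* A nonzero term would need k <= i and k + 1 <= r - i, hence 2k + 1 <= r, against [rk]. *)
  have [ik|ki] := ltnP i k; first by rewrite gbinom_small ?mul0r.
  by rewrite (@gbinom_small (r - i)%N) ?mulr0 //; lia.
split.
- by rewrite HH1E numer1_bin.
- by move=> z; rewrite HH1R -{1}[z]sqrtCK horner_numer1 // pnatr_eq0.
by move=> _; rewrite HH1R; exact: numer1_negative_roots.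
Qed.
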